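(* For every integer $n\ge 5$, the graph $$B_n=Q_n-\{00000\,0^{n-5},\,00001\,0^{n-5},\,00010\,0^{n-5},\,00101\,0^{n-5},\,11011\,1^{n-5},\,11100\,1^{n-5},\,11110\,1^{n-5},\,11111\,1^{n-5}\}$$ is a partial cube with pairwise isomorphic opposite semicubes (that is, for every $\Theta$-class of $B_n$, the two semicubes associated with that $\Theta$-class induce isomorphic subgraphs of $B_n$), but $B_n$ is not antipodal, and, equivalently, not harmonic-even.
   Context: All graphs are undirected, connected, simple and finite; $d_G$ is the usual shortest-path distance. The hypercube $Q_n$ has vertex set $\{0,1\}^n$ (binary words of length $n$), two words being adjacent iff they differ in exactly one coordinate. $0^m$ and $1^m$ denote the words $00\cdots0$ and $11\cdots1$ of length $m$ (empty if $m=0$), and juxtaposition is concatenation. For $S\subseteq V(G)$, $G-S$ is the subgraph induced by $V(G)\setminus S$. A partial cube is a graph isomorphic to an isometric subgraph $H$ of some hypercube, i.e. $d_H(x,y)=d_{Q}(x,y)$ for all $x,y\in V(H)$. The Djokovi\'c–Winkler relation on $E(G)$ is: $uv\,\Theta\,xy$ iff $d_G(u,x)+d_G(v,y)\ne d_G(u,y)+d_G(v,x)$; in a partial cube it is an equivalence relation, and its classes are the $\Theta$-classes. For a $\Theta$-class $E_i$ of a partial cube $G$ and an edge $xy\in E_i$, the two (opposite) semicubes associated with $E_i$ are the sets $W_i^0=\{a\in V(G): d_G(x,a)<d_G(y,a)\}$ and $W_i^1=\{a\in V(G): d_G(y,a)<d_G(x,a)\}$ (independent of the choice of $xy\in E_i$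 up to interchanging the labels $0,1$), and also the subgraphs $G[W_i^0]$, $G[W_i^1]$ they induce. A vertex $y$ is a relative antipode of $x$ in $G$ if $d_G(x,y)\ge d_G(x,z)$ for every neighbor $z$ of $y$. $G$ is antipodal if every vertex has exactly one relative antipode. An absolute antipode of $x$ is a vertex at distance $\operatorname{diam}(G)$ from $x$. $G$ is even if every vertex $x$ has a unique absolute antipode $\bar x$, and harmonic-even if it is even and $x\mapsto\bar x$ is an automorphism of $G$. *)

(* Defs.v *)
From mathcomp Require Import all_boot.

Set Implicit Arguments.
Unset Strict Implicit.
Unset Printing Implicit Defensive.

Record sgraph := SGraph {
  vertex :> finType;
  adj : rel vertex;
  adj_sym : symmetric adj;
  adj_irr : irreflexive adj }.

Definition graph_connected (G : sgraph) : Prop :=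
  forall x y : G, connect (@adj G) x y.

(* A shortest path in a graph with N vertices has fewer than N edges, so the
   search below succeeds exactly when x and y are connected; otherwise it
   returns the junk value #|G|. *)
Definition dist (G : sgraph) (x y : G) : nat :=
  find (fun k => [exists p : k.-tuple G, path (@adj G) x p && (last x p == y)])
       (iota 0 #|G|).

Definition diam (G : sgraph) : nat := \max_(x : G) \max_(y : G) dist x y.

Definition is_graph_iso (G H : sgraph) (f : G -> H) : Prop :=
  bijective f /\ forall x y : G, adj (f x) (f y) = adj x y.

Definition isomorphic (G H : sgraph) : Prop :=
  exists f : G -> H, is_graph_iso f.

(* Only the restriction of sub_adj to sub_vert is relevant. *)
Record subgraph (G : sgraph) := Subgraph {
  sub_vert : {set G};
  sub_adj : rel G;
  sub_adj_sym : symmetric sub_adj;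
  sub_adj_sub : subrel sub_adj (@adj G) }.

Section GraphOfSubgraph.
Variables (G : sgraph) (H : subgraph G).

Definition subgraph_vertex : finType := {x : G | x \in sub_vert H}.

Definition subgraph_adj : rel subgraph_vertex :=
  fun x y => sub_adj H (val x) (val y).

Lemma subgraph_adj_sym : symmetric subgraph_adj.
Proof. by move=> x y; apply: sub_adj_sym. Qed.

Lemma subgraph_adj_irr : irreflexive subgraph_adj.
Proof.
by move=> x; apply/negP => /(@sub_adj_sub _ H); rewrite adj_irr.
Qed.

Definition subgraph_graph : sgraph := SGraph subgraph_adj_sym subgraph_adj_irr.

End GraphOfSubgraph.

Coercion subgraph_graph : subgraph >-> sgraph.

Definition induced (G : sgraph) (A : {set G}) : subgraph G :=
  @Subgraph G A (@adj G) (@adj_sym G) (fun x y h => h).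

Definition remove_vertices (G : sgraph) (S : {set G}) : subgraph G :=
  induced (~: S).

Definition isometric (G : sgraph) (H : subgraph G) : Prop :=
  forall x y : H, dist x y = dist (val x) (val y).

Section Hypercube.
Variable n : nat.

Definition hypercube_adj : rel (n.-tuple bool) :=
  fun x y => #|[set i : 'I_n | tnth x i != tnth y i]| == 1.

Lemma hypercube_adj_sym : symmetric hypercube_adj.
Proof.
move=> x y; rewrite /hypercube_adj; congr (#|pred_of_set _| == 1).
by apply/setP => i; rewrite !inE eq_sym.
Qed.

Lemma hypercube_adj_irr : irreflexive hypercube_adj.
Proof.
move=> x; rewrite /hypercube_adj; apply/negbTE/eqP.
suff -> : [set i : 'I_n | tnth x i != tnth x i] = set0 by rewrite cards0.
by apply/setP => i; rewrite !inE eqxx.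
Qed.

Definition hypercube : sgraph := SGraph hypercube_adj_sym hypercube_adj_irr.

End Hypercube.

(* Connectedness is explicit because dist has a junk value on disconnected
   graphs. *)
Definition partial_cube (G : sgraph) : Prop :=
  graph_connected G /\
  exists (n : nat) (H : subgraph (hypercube n)), isometric H /\ isomorphic G H.

Definition edges (G : sgraph) : {set {set G}} :=
  [set e | [exists x, exists y, adj x y && (e == [set x; y])]].

(* The last condition is invariant under exchanging u and v, or x and y, so it
   does not depend on how the endpoints of the two edges are named. *)
Definition Theta (G : sgraph) : rel {set G} := fun e f =>
  [exists u, exists v, exists x, exists y,
    [&& e == [set u; v], f == [set x; y] &
        dist u x + dist v y != dist u y + dist v x]].

Definition Theta_classes (G : sgraph) : {set {set {set G}}} :=
  equivalence_partition (@Theta G) (edges G).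

(* The semicubes of the Theta-class of an edge xy are semicube x y and
   semicube y x. *)
Definition semicube (G : sgraph) (x y : G) : {set G} :=
  [set a | dist x a < dist y a].

Definition isomorphic_opposite_semicubes (G : sgraph) : Prop :=
  forall E : {set {set G}}, E \in Theta_classes G ->
  forall x y : G, [set x; y] \in E ->
  isomorphic (induced (semicube x y)) (induced (semicube y x)).

Definition relative_antipode (G : sgraph) (x y : G) : Prop :=
  forall z : G, adj y z -> dist x z <= dist x y.

Definition antipodal (G : sgraph) : Prop :=
  forall x : G, exists! y : G, relative_antipode x y.

Definition absolute_antipode (G : sgraph) (x y : G) : Prop :=
  dist x y = diam G.

Definition even_graph (G : sgraph) : Prop :=
  forall x : G, exists! y : G, absolute_antipode x y.

Definition harmonic_even (G : sgraph) : Prop :=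
  even_graph G /\
  exists f : G -> G, (forall x, absolute_antipode x (f x)) /\ is_graph_iso f.

Definition B_removed_words (n : nat) : seq (seq bool) :=
  let O := false in let I := true in
  [seq w ++ nseq (n - 5) O | w <- [:: [:: O; O; O; O; O]; [:: O; O; O; O; I];
                                      [:: O; O; O; I; O]; [:: O; O; I; O; I]]]
  ++
  [seq w ++ nseq (n - 5) I | w <- [:: [:: I; I; O; I; I]; [:: I; I; I; O; O];
                                      [:: I; I; I; I; O]; [:: I; I; I; I; I]]].

Definition B (n : nat) : sgraph :=
  @remove_vertices (hypercube n)
    [set x : n.-tuple bool | tval x \in B_removed_words n].

(* Main.v *)
(* In the hypercube, the removed words are such that from any remaining word one
   can always step towards any other remaining word, so distances in B_n are
   Hamming distances and B_n is a partial cube. Numbering the positions from 0,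
   two involutive automorphisms of Q_n preserve the removed set: complementing
   every position but 4, and complementing everything after exchanging positions
   2 and 3. Each Theta-class is a direction i; the first involution swaps its
   semicubes when i <> 4, the second one when i = 4. Finally 11101 1...1 is in
   B_n but its complement is not, so this vertex has several relative antipodes,
   and no absolute antipode since B_n has diameter n. *)

Require Import Defs.
From mathcomp Require Import all_boot all_fingroup.

Set Implicit Arguments.
Unset Strict Implicit.
Unset Printing Implicit Defensive.

(** * Computing graph distances *)

Definition subgraph_sub (G : sgraph) (H : subgraph G) (x : G)
    (xH : x \in sub_vert H) : H :=
  exist (fun x => x \in sub_vert H) x xH.

(** The first two hypotheses make [h] a lower bound for the length of every path; the third lets a
    path of length exactly [h x y] be built step by step. *)
Lemma connect_dist_eq (G : sgraph) (h : G -> G -> nat) :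
    (forall x, h x x = 0) ->
    (forall x y z, adj x z -> h x y <= (h z y).+1) ->
    (forall x y, x != y -> exists2 z, adj x z & h x y = (h z y).+1) ->
  forall x y, connect (@adj G) x y /\ dist x y = h x y.
Proof.
move=> h0 hS hstep.
have le_path p : forall x y, path (@adj G) x p -> last x p = y ->
    h x y <= size p.
  elim: p => [|z p IHp] x y /=; first by move=> _ <-; rewrite h0.
  case/andP=> xz zp lastp; apply: leq_trans (hS _ y _ xz) _.
  exact: IHp.
have ex_path k : forall x y, h x y = k ->
    exists p, [/\ path (@adj G) x p, last x p = y & size p = k].
  elim: k => [|k IHk] x y hxy.
    exists [::]; split=> //=; apply/eqP/negP => /negP /hstep[z _].
    by rewrite hxy.
  have [eqxy|/hstep[z xz]] := eqVneq x y; first by rewrite eqxy h0 in hxy.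
  rewrite hxy => -[/esym/IHk[p [zp lastp szp]]].
  by exists (z :: p); rewrite /= xz zp lastp szp.
move=> x y; have [p [xp lastp szp]] := ex_path _ x y erefl.
have cxy : connect (@adj G) x y by apply/connectP; exists p.
split=> //; rewrite /dist.
(* [dist] searches only lengths below [#|G|]; a path without repeated vertices shows that [h x y] is
   in that range. *)
have hlt : h x y < #|G|.
  move: xp lastp; rewrite -(prednK (n := #|G|)); last by apply/card_gt0P; exists x.
  move=> xp; case/shortenP: xp => q xq uq _ lastq.
  rewrite ltnS (leq_trans (le_path _ _ _ xq lastq)) //.
  have := max_card [in x :: q]; rewrite (card_uniqP uq) /=.
  by case: #|G|.
set P := (P in find P _).
have Ph : P (h x y).
  by apply/existsP; exists (Tuple (introT eqP szp)); rewrite /= xp lastp eqxx.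
have Pge k : P k -> h x y <= k.
  case/existsP=> q /andP[xq /eqP lastq].
  by rewrite (leq_trans (le_path _ _ _ xq lastq)) // size_tuple.
have hasP : has P (iota 0 #|G|).
  by apply/hasP; exists (h x y) => //; rewrite mem_iota.
have find_lt : find P (iota 0 #|G|) < #|G|.
  by move: hasP; rewrite has_find size_iota.
apply/eqP; rewrite eqn_leq; apply/andP; split; last first.
  by apply: Pge; have := nth_find 0 hasP; rewrite nth_iota.
rewrite leqNgt; apply/negP => /(before_find 0).
by rewrite nth_iota // add0n Ph.
Qed.

Lemma leq_dist_diam (G : sgraph) (x y : G) : dist x y <= diam G.
Proof.
apply: leq_trans (leq_bigmax (F := fun x => \max_(y : G) dist x y) x).
exact: (leq_bigmax (F := fun y => dist x y)).
Qed.

(** * Hamming distance, flips and signed permutations *)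

Section Hamming.
Variable n : nat.
Implicit Types (x y z : n.-tuple bool) (i j : 'I_n).

Definition hamming x y : nat := #|[set i | tnth x i != tnth y i]|.

Definition flip x i : n.-tuple bool := [tuple tnth x j (+) (j == i) | j < n].

Lemma tnth_flip x i j : tnth (flip x i) j = tnth x j (+) (j == i).
Proof. by rewrite tnth_mktuple. Qed.

Lemma nth_flip x i k : nth false (flip x i) k = nth false x k (+) (k == i).
Proof.
have [ltkn|lenk] := ltnP k n.
  by rewrite -[k]/(val (Ordinal ltkn)) -!tnth_nth tnth_flip.
rewrite !nth_default ?size_tuple // gtn_eqF //.
exact: leq_trans (ltn_ord i) lenk.
Qed.

Lemma hamming_xx x : hamming x x = 0.
Proof. by apply/eqP; rewrite cards_eq0; apply/eqP/setP => i; rewrite !inE eqxx. Qed.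

Lemma hamming_le x y : hamming x y <= n.
Proof. by rewrite -[leqRHS]card_ord max_card. Qed.

Lemma hamming_eq_max x y : hamming x y = n -> forall i, tnth y i = ~~ tnth x i.
Proof.
move=> hn i; have : [set i | tnth x i != tnth y i] == setT.
  by rewrite eqEcard subsetT cardsT card_ord -{1}hn /= leqnn.
by move/eqP/setP/(_ i); rewrite !inE; case: (tnth x i) (tnth y i) => -[].
Qed.

Lemma hamming_flip x y i :
  tnth x i != tnth y i -> hamming x y = (hamming (flip x i) y).+1.
Proof.
move=> xyi; rewrite /hamming (cardsD1 i) inE xyi add1n; congr _.+1.
apply: eq_card => j; rewrite !inE tnth_flip.
have [->|_] := eqVneq j i; last by rewrite addbF.
by move: xyi; rewrite addbT; case: (tnth _ _); case: (tnth _ _).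
Qed.

Lemma neq_tupleP x y : reflect (exists i, tnth x i != tnth y i) (x != y).
Proof.
apply: (iffP idP) => [xy|[i xyi]]; last by apply: contraNneq xyi => ->.
apply/existsP; apply: contraR xy; rewrite negb_exists => /forallP xy.
by apply/eqP/eq_from_tnth => i; apply/eqP; rewrite -[_ == _]negbK xy.
Qed.

Lemma adj_flip x i : @adj (hypercube n) x (flip x i).
Proof.
rewrite /= /hypercube_adj; apply/cards1P; exists i; apply/setP => j.
by rewrite !inE tnth_flip; case: (tnth _ _); case: (j == i).
Qed.

Lemma adj_hypercubeP x y :
  reflect (exists i, y = flip x i) (@adj (hypercube n) x y).
Proof.
apply: (iffP idP) => [/cards1P[i xyi]|[i ->]]; last exact: adj_flip.
exists i; apply: eq_from_tnth => j; rewrite tnth_flip.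
by have /setP/(_ j) := xyi; rewrite !inE => <-; case: (tnth _ _); case: (tnth _ _).
Qed.

Lemma flipK i : involutive (flip^~ i).
Proof. by move=> x; apply: eq_from_tnth => j; rewrite !tnth_flip addbK. Qed.

Lemma hamming_flip_eq x y i :
  tnth x i = tnth y i -> hamming (flip x i) y = (hamming x y).+1.
Proof.
move=> xyi; rewrite (@hamming_flip (flip x i) y i) ?flipK //.
by rewrite tnth_flip eqxx xyi; case: (tnth _ _).
Qed.

Lemma hamming_flip_leq x y i : hamming x y <= (hamming (flip x i) y).+1.
Proof.
have [/hamming_flip_eq->|/hamming_flip->//] := eqVneq (tnth x i) (tnth y i).
by rewrite ltnW // ltnS leqnSn.
Qed.

Lemma ltn_hamming_flip x i y :
  (hamming x y < hamming (flip x i) y) = (tnth x i == tnth y i).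
Proof.
have [/hamming_flip_eq->|/hamming_flip->] := eqVneq (tnth x i) (tnth y i).
  by rewrite leqnn.
by apply/negbTE; rewrite -leqNgt leqnSn.
Qed.

Lemma hamming_ge x y : (forall i, tnth x i != tnth y i) -> n <= hamming x y.
Proof.
move=> xy; rewrite -[leqLHS]card_ord -cardsT subset_leq_card //.
by apply/subsetP => i _; rewrite inE.
Qed.

Lemma hamming_ge_pred x y i :
  (forall j, j != i -> tnth x j != tnth y j) -> n.-1 <= hamming x y.
Proof.
move=> xy; rewrite -[n]card_ord -(cardsC1 i) subset_leq_card //.
by apply/subsetP => j; rewrite !inE => /xy.
Qed.

(** The automorphisms of the hypercube are exactly the maps of this form. *)
Definition signed_perm (s : {perm 'I_n}) (b : 'I_n -> bool) x : n.-tuple bool :=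
  [tuple tnth x (s i) (+) b i | i < n].

Lemma tnth_signed_perm s b x i :
  tnth (signed_perm s b x) i = tnth x (s i) (+) b i.
Proof. by rewrite tnth_mktuple. Qed.

Lemma hamming_signed_perm s b x y :
  hamming (signed_perm s b x) (signed_perm s b y) = hamming x y.
Proof.
rewrite /hamming -(card_preimset [set i | tnth x i != tnth y i] (@perm_inj _ s)).
apply: eq_card => i; rewrite !inE !tnth_signed_perm.
by case: (tnth x _) (tnth y _) (b i) => -[] [].
Qed.

End Hamming.

(** * Distances in the hypercube and after deleting vertices *)

Lemma dist_hypercube n (x y : hypercube n) : dist x y = hamming x y.
Proof.
apply: (proj2 (connect_dist_eq _ _ _ x y)) => {x y}.
- exact: hamming_xx.
- by move=> x y z /adj_hypercubeP[i ->]; apply: hamming_flip_leq.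
- move=> x y /neq_tupleP[i xyi]; exists (flip x i); first exact: adj_flip.
  exact: hamming_flip.
Qed.

Section RemoveVertices.
Variables (n : nat) (S : {set hypercube n}).
Hypothesis greedy : forall x y : n.-tuple bool, x \notin S -> y \notin S ->
  x != y -> exists2 i, tnth x i != tnth y i & flip x i \notin S.

Lemma remove_vertices_notin (u : remove_vertices S) : val u \notin S.
Proof. by have := valP u; rewrite /= inE. Qed.

(** [greedy] supplies the third hypothesis of [connect_dist_eq] for the Hamming distance; the other
    two are inherited from the hypercube. *)
Lemma connect_dist_remove_vertices (u v : remove_vertices S) :
  connect (@adj (remove_vertices S)) u v /\ dist u v = hamming (val u) (val v).
Proof.
apply: (@connect_dist_eq (remove_vertices S)
  (fun u v => hamming (val u) (val v))) => {u v}.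
- by move=> u; apply: hamming_xx.
- move=> u v w /adj_hypercubeP[i ->]; exact: hamming_flip_leq.
- move=> u v uv.
  have [i uvi uiS] := greedy (remove_vertices_notin u) (remove_vertices_notin v) uv.
  have uiC : flip (val u) i \in sub_vert (remove_vertices S) by rewrite inE.
  exists (subgraph_sub uiC); first exact: adj_flip.
  exact: hamming_flip.
Qed.

Lemma dist_remove_vertices (u v : remove_vertices S) :
  dist u v = hamming (val u) (val v).
Proof. by case: (connect_dist_remove_vertices u v). Qed.

Lemma partial_cube_remove_vertices : partial_cube (remove_vertices S).
Proof.
split=> [u v|]; first by case: (connect_dist_remove_vertices u v).
exists n, (remove_vertices S); split=> [u v|].
  by rewrite dist_remove_vertices dist_hypercube.
by exists id; split=> //; exists id.
Qed.

(** The distances from the two ends of an edge in direction [i] are compared by coordinate [i]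
    alone, so semicubes are traces of half-cubes. *)
Lemma mem_semicube_flip (u v w : remove_vertices S) i :
  val v = flip (val u) i ->
  (w \in semicube u v) = (tnth (val u) i == tnth (val w) i).
Proof.
by move=> vE; rewrite inE !dist_remove_vertices vE ltn_hamming_flip.
Qed.

End RemoveVertices.

(** * Semicubes exchanged by an involution *)

Lemma isomorphic_induced (G : sgraph) (g : G -> G) (A A' : {set G}) :
    involutive g -> (forall x y, adj (g x) (g y) = adj x y) ->
    (forall x, (g x \in A') = (x \in A)) ->
  isomorphic (induced A) (induced A').
Proof.
move=> gK gadj gA.
have gP (u : induced A) : g (val u) \in sub_vert (induced A').
  by rewrite /= gA; apply: (valP u).
have gP' (u : induced A') : g (val u) \in sub_vert (induced A).
  by rewrite /= -gA gK; apply: (valP u).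
exists (fun u => subgraph_sub (gP u)); split=> [|u v]; last exact: gadj.
by exists (fun u => subgraph_sub (gP' u)) => u; apply: val_inj; rewrite /= gK.
Qed.

(** A signed permutation preserving [S] acts on the remaining graph; fixing position [i] and
    complementing its bit, it exchanges the two halves in direction [i]. *)
Lemma isomorphic_semicubes_remove_vertices n (S : {set hypercube n}) s b i
    (u v : remove_vertices S) :
    (forall x y : n.-tuple bool, x \notin S -> y \notin S ->
      x != y -> exists2 i, tnth x i != tnth y i & flip x i \notin S) ->
    involutive (signed_perm s b) ->
    (forall x, (signed_perm s b x \in S) = (x \in S)) ->
    s i = i -> b i -> val v = flip (val u) i ->
  isomorphic (induced (semicube u v)) (induced (semicube v u)).
Proof.
move=> greedy gK gS si bi vE.
have gP (w : remove_vertices S) :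
    signed_perm s b (val w) \in sub_vert (remove_vertices S).
  by rewrite /= inE gS remove_vertices_notin.
have uE : val u = flip (val v) i by rewrite vE flipK.
apply: (isomorphic_induced (g := fun w => subgraph_sub (gP w))) => [w|w w'|w].
- by apply: val_inj; rewrite /= gK.
(* Adjacency unfolds to Hamming distance 1. *)
- exact: (congr1 (eq_op^~ 1) (hamming_signed_perm s b (val w) (val w'))).
- rewrite (mem_semicube_flip greedy _ uE) (mem_semicube_flip greedy _ vE) /=.
  rewrite tnth_signed_perm si bi vE tnth_flip eqxx.
  by case: (tnth _ _); case: (tnth _ _).
Qed.

Lemma signed_permK n (s : {perm 'I_n}) (b : 'I_n -> bool) :
    (forall i, s (s i) = i) -> (forall i, b (s i) = b i) ->
  involutive (signed_perm s b).
Proof.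
move=> sK bs x; apply: eq_from_tnth => i.
by rewrite !tnth_signed_perm sK bs addbK.
Qed.

Lemma nth_signed_perm n s b (x : n.-tuple bool) (i : 'I_n) :
  nth false (signed_perm s b x) i = nth false x (s i) (+) b i.
Proof. by rewrite -!tnth_nth tnth_signed_perm. Qed.

(** * The removed words and the greedy step *)

Definition removed n : {set hypercube n} :=
  [set x : n.-tuple bool | tval x \in B_removed_words n].

(* In a removed word all positions except 2, 3, 4 share a value c; a and b are
   positions 2 and 3 shifted by c, and d is position 4 unshifted. Then
   abd ranges over 000, 001, 010, 101 for c = 0 as well as for c = 1. *)
Definition removed_pattern (a b d : bool) : bool :=
  if a then ~~ b && d else ~~ (b && d).

(** Replaces list membership by conditions on positions, on which flips and signed permutations act
    directly. *)
Lemma removedP m (x : m.+4.+1.-tuple bool) :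
  reflect (exists2 c,
      forall k, k < m.+4.+1 -> k \notin [:: 2; 3; 4] -> nth false x k = c &
      removed_pattern (nth false x 2 (+) c) (nth false x 3 (+) c) (nth false x 4))
    (x \in removed m.+4.+1).
Proof.
have tailP (t : m.-tuple bool) c :
    reflect (forall k, k < m -> nth false t k = c) (tval t == nseq m c).
  apply: (iffP eqP) => [-> k km|tc]; first by rewrite nth_nseq km.
  apply: (@eq_from_nth _ false); rewrite ?size_nseq size_tuple // => k km.
  by rewrite nth_nseq km tc.
case/tupleP: x => x0 x; case/tupleP: x => x1 x; case/tupleP: x => x2 x.
case/tupleP: x => x3 x; case/tupleP: x => x4 t.
have -> : ([tuple of x0 :: [tuple of x1 :: [tuple of x2 :: [tuple of x3 ::
    [tuple of x4 :: t]]]]] \in removed m.+4.+1) =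
    [&& x0 == x1, removed_pattern (x2 (+) x0) (x3 (+) x0) x4 & tval t == nseq m x0].
  rewrite inE /B_removed_words /= !inE !eqseq_cons !subSS subn0.
  by case: x0 x1 x2 x3 x4 => -[] [] [] []; rewrite /= ?andbF ?orbF.
apply: (iffP and3P) => [[/eqP<- pat /tailP tx]|[c xc]] /=.
  exists x0 => // -[|[|[|[|[|k]]]]] //= km _.
  exact: tx.
have /= -> := xc 0 isT isT; have /= -> := xc 1 isT isT.
by move=> pat; split=> //; apply/tailP => k km; have := xc k.+4.+1 km isT.
Qed.

(** The removed patterns form the path 010, 000, 001, 101 in the 3-cube. A non-removed pattern with
    two removed neighbours is 011 or 100; the fourth corner of the square is then 000 or 001, and
    one of the two directions is position 4. *)
Lemma removed_flip2 m (x : m.+4.+1.-tuple bool) (i j : 'I_m.+4.+1) :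
    x \notin removed m.+4.+1 -> i != j ->
    flip x i \in removed m.+4.+1 -> flip x j \in removed m.+4.+1 ->
  flip (flip x i) j \in removed m.+4.+1 /\ ((i == 4 :> nat) || (j == 4 :> nat)).
Proof.
move=> /removedP xS; rewrite -val_eqE /=.
move=> ij /removedP[c xi pati] /removedP[c' xj patj].
(* Different constants would force [i] and [j] to be positions 0 and 1; then [c] and [c'] give
   patterns differing by complementing both [a] and [b], which are never both removed. *)
have ecc' : c = c'.
  move: (xi 0 isT isT) (xi 1 isT isT) (xj 0 isT isT) (xj 1 isT isT) pati patj ij.
  rewrite !nth_flip => {xi xj}.
  case: (nat_of_ord i) => [|[|i']]; case: (nat_of_ord j) => [|[|j']] //=;
  by case: c c' (nth _ _ 0) (nth _ _ 1) (nth _ _ 2) (nth _ _ 3) (nth _ _ 4)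
    => -[] [] [] [] [] [].
subst c'.
(* Otherwise both flipped words have the value [c] at position [i], where they differ. *)
have mem_i : val i \in [:: 2; 3; 4].
  apply: contraT => iN; move: (xi _ (ltn_ord i) iN) (xj _ (ltn_ord i) iN).
  by rewrite !nth_flip eqxx (negPf ij) => <-; case: (nth _ _ _).
have mem_j : val j \in [:: 2; 3; 4].
  apply: contraT => jN; move: (xi _ (ltn_ord j) jN) (xj _ (ltn_ord j) jN).
  by rewrite !nth_flip eqxx eq_sym (negPf ij) => <-; case: (nth _ _ _).
have xc k : k < m.+4.+1 -> k \notin [:: 2; 3; 4] -> nth false x k = c.
  move=> km kN; rewrite -(xi k km kN) nth_flip.
  by case: eqP kN => [->|]; rewrite ?mem_i ?addbF.
have xN : ~~ removed_pattern (nth false x 2 (+) c) (nth false x 3 (+) c) (nth false x 4).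
  by apply/negP => pat; apply: xS; exists c.
suff [pat i4] : removed_pattern
    (nth false (flip (flip x i) j) 2 (+) c) (nth false (flip (flip x i) j) 3 (+) c)
    (nth false (flip (flip x i) j) 4) /\ ((i == 4 :> nat) || (j == 4 :> nat)).
  split=> //; apply/removedP; exists c => // k km kN.
  rewrite !nth_flip xc //.
  by case: eqP kN => [->|_]; case: eqP => [->|_] //; rewrite ?mem_i ?mem_j ?addbF.
move: pati patj xN ij mem_i mem_j; rewrite !nth_flip !inE /=.
case: (nat_of_ord i) => [|[|[|[|[|?]]]]] //; case: (nat_of_ord j) => [|[|[|[|[|?]]]]] //=;
by case: c (nth _ _ 2) (nth _ _ 3) (nth _ _ 4) {xc xi xj} => -[] [] [].
Qed.

(** If every step towards [y] were blocked, then [y], not being removed, would differ from each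
    removed word reached. This yields a second and a third differing position, to which
    [removed_flip2] applies pairwise. *)
Lemma removed_greedy m (x y : m.+4.+1.-tuple bool) :
    x \notin removed m.+4.+1 -> y \notin removed m.+4.+1 -> x != y ->
  exists2 i, tnth x i != tnth y i & flip x i \notin removed m.+4.+1.
Proof.
move=> xS yS xy; apply/exists_inP; apply: contraT.
rewrite negb_exists_in => /forall_inP noflip.
have flipS i : tnth x i != tnth y i -> flip x i \in removed m.+4.+1.
  by move/noflip; rewrite negbK.
have neq_y z : z \in removed m.+4.+1 -> exists i, tnth z i != tnth y i.
  by move=> zS; apply/neq_tupleP; apply: contraNneq yS => <-.
have /neq_tupleP[i xyi] := xy.
have [j] := neq_y _ (flipS i xyi); rewrite tnth_flip.
have [->|ji] := eqVneq j i.
  by move: xyi; case: (tnth _ _); case: (tnth _ _).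
rewrite addbF => xyj.
have ij : i != j by rewrite eq_sym.
have [fS ij4] := removed_flip2 xS ij (flipS i xyi) (flipS j xyj).
have [k] := neq_y _ fS; rewrite !tnth_flip.
have [->|ki] := eqVneq k i.
  by rewrite (negPf ij); move: xyi; case: (tnth _ _); case: (tnth _ _).
have [->|kj] := eqVneq k j.
  by move: xyj; case: (tnth _ _); case: (tnth _ _).
rewrite !addbF => xyk.
have [_ ik4] := removed_flip2 xS ki (flipS k xyk) (flipS i xyi).
have [_ jk4] := removed_flip2 xS kj (flipS k xyk) (flipS j xyj).
(* Position 4 would lie in each of the three pairs from distinct [i], [j], [k]. *)
move: ik4 jk4 ij ki kj; rewrite -!val_eqE /=.
by case: eqP ij4 => [->|_] /=; case: eqP => [->|_] //=; case: eqP => [->|_].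
Qed.

(** * Two symmetries of the removed set *)

Section Symmetries.
Variable m : nat.
Local Notation n := m.+4.+1.

Let o2 : 'I_n := @Ordinal n 2 isT.
Let o3 : 'I_n := @Ordinal n 3 isT.
Let o4 : 'I_n := @Ordinal n 4 isT.

Definition swap_complement : n.-tuple bool -> n.-tuple bool :=
  signed_perm (tperm o2 o3) (fun=> true).

Definition complement_but4 : n.-tuple bool -> n.-tuple bool :=
  signed_perm 1%g (fun i => i != o4).

Lemma swap_complementK : involutive swap_complement.
Proof. by apply: signed_permK => // i; rewrite tpermK. Qed.

Lemma complement_but4K : involutive complement_but4.
Proof. by apply: signed_permK => i; rewrite !perm1. Qed.

Lemma involutive_removed (g : n.-tuple bool -> n.-tuple bool) :
    involutive g -> (forall x, x \in removed n -> g x \in removed n) ->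
  forall x, (g x \in removed n) = (x \in removed n).
Proof. by move=> gK gS x; apply/idP/idP => /gS //; rewrite gK. Qed.

(** The constant [c] is complemented and the pattern [(a, b, d)] becomes [(b, a, ~~ d)], which
    reverses the path 010, 000, 001, 101. *)
Lemma swap_complement_removed x :
  (swap_complement x \in removed n) = (x \in removed n).
Proof.
apply: involutive_removed swap_complementK _ x => x /removedP[c xc pat].
apply/removedP; exists (~~ c) => [k km kN|].
  rewrite -[k]/(val (Ordinal km)) nth_signed_perm tpermD ?xc ?addbT //.
  - by apply: contraNneq kN => /(congr1 val) /= <-.
  - by apply: contraNneq kN => /(congr1 val) /= <-.
rewrite (nth_signed_perm _ _ _ o2) (nth_signed_perm _ _ _ o3).
rewrite (nth_signed_perm _ _ _ o4) tpermL tpermR tpermD //=.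
by move: pat; case: c (nth _ _ 2) (nth _ _ 3) (nth _ _ 4) {xc} => -[] [] [].
Qed.

(** Here [c] is complemented while the pattern stays the same. *)
Lemma complement_but4_removed x :
  (complement_but4 x \in removed n) = (x \in removed n).
Proof.
apply: involutive_removed complement_but4K _ x => x /removedP[c xc pat].
apply/removedP; exists (~~ c) => [k km kN|].
  rewrite -[k]/(val (Ordinal km)) nth_signed_perm perm1 /= xc //.
  have -> : Ordinal km != o4 by apply: contraNneq kN => /(congr1 val) /= ->.
  by rewrite addbT.
rewrite (nth_signed_perm _ _ _ o2) (nth_signed_perm _ _ _ o3).
rewrite (nth_signed_perm _ _ _ o4) !perm1 /=.
by move: pat; case: c (nth _ _ 2) (nth _ _ 3) (nth _ _ 4) {xc} => -[] [] [].
Qed.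

Lemma isomorphic_semicubes_B : isomorphic_opposite_semicubes (B n).
Proof.
move=> E EC u v uvE.
have /adj_hypercubeP[i vE] : adj u v.
  (* A class consists of edges, so the unordered pair is that of two adjacent vertices. *)
  have : [set u; v] \in edges (B n).
    case/imsetP: EC uvE => e _ ->.
    by rewrite inE => /andP[].
  rewrite inE => /existsP[u'] /existsP[v'] /andP[uv' /eqP euv].
  have := set22 u' v'; have := set21 u' v'; rewrite -euv !inE.
  case/orP=> /eqP eu; case/orP=> /eqP ev; move: uv'; rewrite eu ev ?adj_irr //.
  by rewrite adj_sym.
have [i4|i4] := eqVneq i o4.
  apply: isomorphic_semicubes_remove_vertices vE => //.
  - exact: removed_greedy.
  - exact: swap_complementK.
  - exact: swap_complement_removed.
  - by rewrite i4 tpermD.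
apply: isomorphic_semicubes_remove_vertices vE.
- exact: removed_greedy.
- exact: complement_but4K.
- exact: complement_but4_removed.
- exact: perm1.
- exact: i4.
Qed.

(** * Antipodes and the diameter *)

Definition word (a b c d e f : bool) : n.-tuple bool :=
  [tuple of [:: a, b, c, d, e & nseq_tuple m f]].

(** The criterion ignores the tail, so for concrete bits it holds by computation. *)
Lemma word_vertex (a b c d e f : bool) :
  (a != b) || ~~ removed_pattern (c (+) a) (d (+) a) e ->
  word a b c d e f \in sub_vert (remove_vertices (removed n)).
Proof.
rewrite in_setC => abcde; apply/removedP => -[k xk].
move: (xk 0 isT isT) (xk 1 isT isT) abcde => /= -> ->.
by rewrite eqxx => /negP.
Qed.

Let dist_B (u v : B n) : dist u v = hamming (val u) (val v).
Proof. exact: (dist_remove_vertices (@removed_greedy m)). Qed.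

(* Its complement 00010...0 is removed, while 00011...0 and 00110...0 are not. *)
Let far : B n := subgraph_sub (@word_vertex true true true false true true isT).

(** Distance [n] would make [v] the complement of [far], which is removed with constant 0 and
    pattern 010. *)
Lemma dist_far_lt (v : B n) : dist far v < n.
Proof.
rewrite dist_B ltn_neqAle hamming_le andbT.
apply: contra (remove_vertices_notin v) => /eqP/hamming_eq_max vE.
have nthE k : k < n -> nth false (val v) k = ~~ nth false (val far) k.
  by move=> km; rewrite -[k]/(val (Ordinal km)) -!tnth_nth vE.
apply/removedP; exists false; last by rewrite !nthE.
move=> k km kN; rewrite nthE //.
by case: k km kN => [|[|[|[|[|k]]]]] //= km _; rewrite nth_nseq (km : k < m).
Qed.

(** No vertex is farther than [n - 1] from [far], so any vertex at that distance qualifies. *)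
Lemma relative_antipode_far (v : B n) (i : 'I_n) :
    (forall j, j != i -> tnth (val far) j != tnth (val v) j) ->
  relative_antipode far v.
Proof.
move=> far_v w _; apply: (@leq_trans n.-1); first exact: dist_far_lt.
by rewrite dist_B; apply: hamming_ge_pred far_v.
Qed.

Lemma not_antipodal_B : ~ antipodal (B n).
Proof.
move=> /(_ far)[a [_ aU]].
(* [v] and [w] are the complement of [far] with position 4, respectively 2, flipped. *)
pose v : B n := subgraph_sub (@word_vertex false false false true true false isT).
pose w : B n := subgraph_sub (@word_vertex false false true true false false isT).
suff [/aU av /aU aw] : relative_antipode far v /\ relative_antipode far w.
  by have /(congr1 val) : v = w by rewrite -av -aw.
split; [apply: (@relative_antipode_far _ o4) | apply: (@relative_antipode_far _ o2)];
move=> j; rewrite !(tnth_nth false);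
by case: j => [[|[|[|[|[|k]]]]] km] //= _; rewrite !nth_nseq (km : k < m).
Qed.

Lemma leq_diam_B : n <= diam (B n).
Proof.
(* Complementary words whose first two bits differ, so neither is removed. *)
pose p : B n := subgraph_sub (@word_vertex false true false true false false isT).
pose q : B n := subgraph_sub (@word_vertex true false true false true true isT).
apply: leq_trans (leq_dist_diam p q).
rewrite dist_B; apply: hamming_ge => j; rewrite !(tnth_nth false).
by case: j => [[|[|[|[|[|k]]]]] km] //=; rewrite !nth_nseq (km : k < m).
Qed.

Lemma not_even_B : ~ even_graph (B n).
Proof.
move=> /(_ far)[v [vA _]].
by have := leq_diam_B; rewrite -vA leqNgt dist_far_lt.
Qed.

End Symmetries.

Theorem theorem3p5 (n : nat) (hn : 5 <= n) :
  partial_cube (B n) /\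
  isomorphic_opposite_semicubes (B n) /\
  ~ antipodal (B n) /\
  ~ harmonic_even (B n).
Proof.
case: n hn => [|[|[|[|[|m]]]]] // _; split.
  exact: partial_cube_remove_vertices (@removed_greedy m).
split; first exact: isomorphic_semicubes_B.
by split; [exact: not_antipodal_B | case=> /not_even_B].
Qed.
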